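(* Let $q$ be a prime power and let $\mathcal{C}\subseteq\mathbb{F}_q^N$ be a $(u,v)$-ordered-batch code of dimension $n$ and redundancy $r=N-n$, where $u,v$ are positive integers. Assume $q\ge\max\{4u\binom{n}{u},7\}$, $v\ge2$ and $uv\le n$. Then $$\binom{r+2u+1-v}{2u}+\sum_{i=1}^{u}\binom{r+2u+1-(v+i)}{2u-i}\binom{v+i-3}{i}\ \ge\ \binom{n}{u},$$ with the convention $\binom{a}{b}=0$ whenever $a<b$.
   Context: $[m]=\{1,\dots,m\}$. A linear code $\mathcal{C}\subseteq\mathbb{F}^N$ of dimension $n$ is systematic if for every $\mathbf{x}\in\mathbb{F}^n$ there is a unique codeword whose first $n$ coordinates equal $\mathbf{x}$. A set $R\subseteq[N]$ is a recovering set for $i\in[n]$ if there are scalars $\lambda_k$ ($k\in R$) with $\mathbf{c}(i)=\sum_{k\in R}\lambda_k\mathbf{c}(k)$ for all $\mathbf{c}\in\mathcal{C}$. $(u,v)$-ordered-batch code: a systematic linear code $\mathcal{C}\subseteq\mathbb{F}^N$ of dimension $n$ such that for every set $I=\{i_1,\dots,i_u\}\subseteq[n]$ of $u$ distinct indices there exist $uv$ pairwise disjoint sets $R_{j,l}\subseteq[N]$ ($j\in[u]$, $l\in[v]$), each $R_{j,l}$ a recovering set for $i_j$, such that the directed graph $D_I$ with vertex set $I$ and an arc $i_j\to i_k$ (for $j,k\in[u]$, $j=k$ allowed) whenever $i_k\in\bigcup_{l=1}^{v}R_{j,l}$, is acyclic (no directed cycles, no loops). *)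

(* Defs.v *)
From HB Require Import structures.
From mathcomp Require Import all_boot all_order all_algebra all_field.
Set Implicit Arguments. Unset Strict Implicit. Unset Printing Implicit Defensive.
Import GRing.Theory.
Local Open Scope ring_scope.

(* Coordinates of a codeword c : 'rV[F]_N are indexed by 'I_N = {0,..,N-1};
   the paper's coordinate k \in [N] corresponds to the ordinal k-1.
   Information (systematic) coordinates [n] correspond to ordinals i with i < n. *)

Definition systematic (F : fieldType) (N n : nat) (C : {vspace 'rV[F]_N}) : Prop :=
  forall x : 'rV[F]_n, exists! c : 'rV[F]_N,
    c \in C /\ (forall (j : 'I_n) (i : 'I_N), val i = val j -> c 0 i = x 0 j).

Definition recovering_set (F : fieldType) (N : nat) (C : {vspace 'rV[F]_N})
  (i : 'I_N) (R : {set 'I_N}) : Prop :=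
  exists lambda : 'I_N -> F,
    forall c : 'rV[F]_N, c \in C -> c 0 i = \sum_(k in R) lambda k * c 0 k.

Definition DI_arc (N u v : nat) (I : {set 'I_N}) (R : 'I_N -> 'I_v -> {set 'I_N})
  : rel 'I_N :=
  fun i k => [&& i \in I, k \in I & k \in \bigcup_(l < v) R i l].

(* acyclic: no directed cycle and no loop, i.e. no x with an arc x -> y and a
   (possibly empty) directed path y ->* x *)
Definition acyclic_rel (T : finType) (e : rel T) : Prop :=
  forall x y : T, e x y -> ~~ connect e y x.

Definition ordered_batch_code (F : fieldType) (N n u v : nat)
  (C : {vspace 'rV[F]_N}) : Prop :=
  systematic n C /\ (\dim C = n)%N /\
  forall I : {set 'I_N},
    (forall i, i \in I -> (val i < n)%N) -> #|I| = u ->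
    exists R : 'I_N -> 'I_v -> {set 'I_N},
      [/\ forall i l, i \in I -> recovering_set C i (R i l),
          forall i l i' l', i \in I -> i' \in I -> (i, l) != (i', l') ->
             [disjoint R i l & R i' l'] &
          acyclic_rel (DI_arc u I R)].

(* Main.v *)
Require Import Defs.
From HB Require Import structures.
From mathcomp Require Import all_boot all_order all_algebra all_field.
From mathcomp Require Import fingroup perm.
From mathcomp Require Import zify.

(** Write t = v - 2 and r = N - n. A recovering set of i that avoids i is a dual
    codeword with entry 1 at i, so a request set I of size u provides, for each
    i_j in I, v dual words g_{j,1}, ..., g_{j,v} whose supports meet only at i_j;
    they are linearly independent. For t generic linear functionals on the
    r-dimensional dual code, the span of the first v - 1 words contains a word a_j
    killed by all of them and with entry 1 at i_j. Put b_j = g_{j,v}, and let P_I be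
    the product of the 2u linear forms a_j, b_j. For a request set I', take the
    coefficient of prod_{k in I'} t_k^2 in P_I evaluated at sum_{k in I'} t_k e_k,
    where e_k is the linear functional reading the k-th entry of a dual word. If I' <> I it vanishes, since some k in I' \ I lies in the
    support of at most one of the forms; if I' = I, acyclicity leaves a single
    nonzero term. Hence the P_I are linearly independent. They are forms of degree
    2u in r variables, of degree at most u in the t variables that do not vanish on
    the words killed by the functionals; the number of such monomials is the
    left-hand side of the bound. *)

Set Implicit Arguments. Unset Strict Implicit. Unset Printing Implicit Defensive.
Import GRing.Theory.
Local Open Scope ring_scope.

(** * Dimension count by rank *)

(** An invertible diagonal matrix of rank [#|T|] factors through dimension [size L]; this combines
    linear independence with the dimension count. *)
Lemma card_le_diag_factor (F : fieldType) (T : finType) (K : eqType)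
    (L : seq K) (A : T -> K -> F) (B : K -> T -> F) :
  (forall x, \sum_(k <- L) A x k * B k x != 0) ->
  (forall x y, x != y -> \sum_(k <- L) A x k * B k y = 0) ->
  (#|T| <= size L)%N.
Proof.
move=> Hd Ho.
pose MA := \matrix_(i < #|T|, j < size L) A (enum_val i) (tnth (in_tuple L) j).
pose MB := \matrix_(j < size L, i < #|T|) B (tnth (in_tuple L) j) (enum_val i).
pose dv := \row_(i < #|T|) \sum_(k <- L) A (enum_val i) k * B k (enum_val i).
have eqM : MA *m MB = diag_mx dv.
  apply/matrixP=> i j; rewrite !mxE.
  under eq_bigr do rewrite !mxE.
  rewrite -(big_tnth _ _ L xpredT (fun k => A (enum_val i) k * B k (enum_val j))).
  case: eqVneq => [->|ne]; first by rewrite mulr1n.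
  by rewrite mulr0n Ho // (inj_eq enum_val_inj).
have : diag_mx dv \in unitmx.
  rewrite unitmxE det_diag unitfE; apply/prodf_neq0 => i _; rewrite mxE; exact: Hd.
rewrite -row_free_unit -eqM /row_free => /eqP <-.
exact: leq_trans (mulmx_max_rank _ _) _.
Qed.

(** * Monomials in two groups of variables *)

Definition msets m d : seq (seq 'I_m) :=
  [seq val t | t <- enum [set t : d.-tuple 'I_m | sorted leq [seq val i | i <- t]]].

Lemma size_msets m d : size (msets m d) = 'C((m + d - 1)%N, d).
Proof.
rewrite size_map -cardE; case: m => [|m]; last first.
  by rewrite card_sorted_tuples addSn subn1 addnC.
(* For [m = 0] truncation gives the right values: 1 for the empty multiset, 0 if [d > 0]. *)
case: d => [|d]; last first.
  rewrite add0n subn1 /= bin_small // eq_card0 // => t.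
  by case: (tnth t ord0).
rewrite bin0 -[RHS](card_tuple 0 'I_0); apply: eq_card => t.
by rewrite !inE tuple0.
Qed.

Lemma mem_msets m (l : seq 'I_m) :
  sort (relpre val leq) l \in msets m (size l).
Proof.
have sz : size (sort (relpre val leq) l) == size l by rewrite size_sort.
apply/mapP; exists (Tuple sz) => //; rewrite mem_enum inE /= sorted_map.
by apply: sort_sorted => i j /=; apply: leq_total.
Qed.

Definition lefts A B (J : seq (A + B)) : seq A :=
  pmap (fun b => if b is inl a then Some a else None) J.
Definition rights A B (J : seq (A + B)) : seq B :=
  pmap (fun b => if b is inr a then Some a else None) J.

Lemma perm_lefts_rights (A B : eqType) (J : seq (A + B)) :
  perm_eq J (map inl (lefts J) ++ map inr (rights J)).
Proof.
elim: J => [|[a|b] J IH] //=; first by rewrite perm_cons.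
by rewrite perm_sym perm_catC /= perm_cons perm_sym (permPr (permEl (perm_catC _ _))).
Qed.

Lemma size_lefts_rights A B (J : seq (A + B)) :
  (size (lefts J) + size (rights J) = size J)%N.
Proof. by elim: J => [|[a|b] J IH] //=; rewrite -IH ?addSn ?addnS. Qed.

(* The multiset of letters of a word, hence a monomial. *)
Definition key s t (J : seq ('I_s + 'I_t)) :=
  (sort (relpre val leq) (lefts J), sort (relpre val leq) (rights J)).

Lemma key_perm s t (J J' : seq ('I_s + 'I_t)) : key J = key J' -> perm_eq J J'.
Proof.
move=> [el er].
rewrite (permPl (perm_lefts_rights J)) perm_sym (permPl (perm_lefts_rights J')).
apply: perm_cat; apply: perm_map.
  by rewrite -(perm_sort (relpre val leq)) -el perm_sort.
by rewrite -(perm_sort (relpre val leq)) -er perm_sort.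
Qed.

(** Here [i] is the degree in the [t] right variables; for [i <= n] the total degree is [n]. *)
Definition keys s t n u : seq (seq 'I_s * seq 'I_t) :=
  [seq ab | i <- iota 0 u.+1, ab <- [seq (a, b) | a <- msets s (n - i)%N, b <- msets t i]].

Lemma size_keys s t n u : size (keys s t n u) =
  (\sum_(0 <= i < u.+1) 'C(s + (n - i) - 1, n - i) * 'C(t + i - 1, i))%N.
Proof.
rewrite size_allpairs_dep sumnE big_map /index_iota subn0.
by apply: eq_bigr => i _; rewrite size_allpairs !size_msets.
Qed.

Lemma mem_keys s t n u (J : seq ('I_s + 'I_t)) :
  size J = n -> (size (rights J) <= u)%N -> key J \in keys s t n u.
Proof.
move=> szJ le; apply/allpairsPdep; exists (size (rights J)), (key J).
rewrite mem_iota add0n ltnS le; split=> //.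
apply/allpairsP; exists (key J); split=> //=; last exact: mem_msets.
by rewrite -szJ -size_lefts_rights addnK mem_msets.
Qed.

(** * Coefficients of products of linear forms *)

Section Polar.
Variables (F : fieldType) (N n : nat).
Implicit Types (p : {set 'I_N}) (f : 'I_n -> 'I_N -> F).

(** Choices of one term per factor whose product is the square of prod_(k in p) t_k. *)
Definition fib2 p (sg : {ffun 'I_n -> 'I_N}) :=
  [forall k, #|[set m | sg m == k]| == (k \in p).*2].

(* The coefficient of prod_(k in p) t_k^2 in prod_m (sum_k t_k f_m(k)). *)
Definition polar p f : F :=
  \sum_(sg : {ffun 'I_n -> 'I_N} | fib2 p sg) \prod_m f m (sg m).

Lemma eq_polar p f g : (forall m k, f m k = g m k) -> polar p f = polar p g.
Proof. by move=> e; apply: eq_bigr => sg _; apply: eq_bigr => m _. Qed.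

Lemma polar_perm p f (q : 'S_n) : polar p (fun m => f (q m)) = polar p f.
Proof.
have fibq (a : 'S_n) (sg : {ffun 'I_n -> 'I_N}) :
    fib2 p [ffun m => sg (a m)] = fib2 p sg.
  apply: eq_forallb => k; congr (_ == _).
  rewrite -(card_preimset [set m | sg m == k] (@perm_inj _ a)).
  by apply: eq_card => m; rewrite !inE ffunE.
rewrite /polar [RHS](reindex (fun sg : {ffun 'I_n -> 'I_N} => [ffun m => sg ((q^-1)%g m)])) /=.
  apply: eq_big => [sg|sg _]; first by rewrite fibq.
  rewrite [RHS](reindex_inj (@perm_inj _ q)); apply: eq_bigr => m _.
  by rewrite ffunE permK.
exists (fun sg : {ffun 'I_n -> 'I_N} => [ffun m => sg (q m)]) => sg _;
  by apply/ffunP => m; rewrite !ffunE ?permK ?permKV.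
Qed.

Lemma polar_sum (I : finType) p (X : 'I_n -> I -> F) (G : I -> 'I_N -> F) :
  polar p (fun m k => \sum_b X m b * G b k) =
  \sum_(J : {ffun 'I_n -> I}) (\prod_m X m (J m)) * polar p (fun m => G (J m)).
Proof.
rewrite /polar; under eq_bigr => sg _ do rewrite bigA_distr_bigA /=.
rewrite exchange_big /=; apply: eq_bigr => J _.
by rewrite mulr_sumr; apply: eq_bigr => sg _; rewrite big_split.
Qed.

(** Every term of the coefficient takes t_k from two distinct factors, but at most one factor
    involves it. *)
Lemma polar_eq0 p f k : k \in p ->
  (forall m m', f m k != 0 -> f m' k != 0 -> m = m') ->
  polar p f = 0.
Proof.
move=> kp uni; apply: big1 => sg /forallP /(_ k).
rewrite kp => /cards2P [m [m' [ne e]]].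
apply/eqP; apply: contraNT ne => /prodf_neq0 nz.
have hit x : x \in [set m; m'] -> f x k != 0.
  by rewrite -e inE => /eqP <-; apply: nz.
by apply/eqP/uni; apply: hit; rewrite !inE eqxx ?orbT.
Qed.

Lemma sum_fib2 p sg (h : 'I_N -> nat) : fib2 p sg ->
  (\sum_m h (sg m) = \sum_k (k \in p).*2 * h k)%N.
Proof.
move=> /forallP fsg; rewrite (partition_big sg xpredT) //=.
apply: eq_bigr => k _; rewrite -(eqP (fsg k)) -sum1_card big_distrl /=.
by apply: eq_big => [m|m /eqP ->]; rewrite ?inE ?mul1n.
Qed.

(* Total height is the same for all maps with prescribed fibres, so moving
   every slot weakly downwards is only possible by moving none. *)
Lemma polar_neq0 p f (own : {ffun 'I_n -> 'I_N}) (h : 'I_N -> nat) :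
  fib2 p own ->
  (forall m, f m (own m) != 0) ->
  (forall m k, k \in p -> f m k != 0 -> k = own m \/ (h k < h (own m))%N) ->
  polar p f != 0.
Proof.
move=> fown nz low; rewrite /polar (bigD1 own) //= [X in _ + X]big1 ?addr0.
  by apply/prodf_neq0.
move=> sg /andP[fsg ne]; apply/eqP; apply: contraNT ne => /prodf_neq0 nzs.
have insg m : sg m \in p.
  have /forallP /(_ (sg m)) := fsg; case: (sg m \in p) => //=.
  by rewrite cards_eq0 => /eqP/setP/(_ m); rewrite !inE eqxx.
have le m : (h (sg m) <= h (own m) ?= iff (sg m == own m))%N.
  split; first by case: (low m _ (insg m) (nzs m isT)) => [->|/ltnW].
  by case: (low m _ (insg m) (nzs m isT)) => [->|lt]; rewrite ?eqxx //;
     rewrite (ltn_eqF lt); apply/esym/eqP => e; rewrite e ltnn in lt.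
have [_ ] := leqif_sum (fun m (_ : xpredT m) => le m).
rewrite !(sum_fib2 _ fsg) !(sum_fib2 _ fown) eqxx => /esym/forallP all.
by apply/eqP/ffunP => m; apply/eqP; apply: all.
Qed.

End Polar.

(** * Independence of products of linear forms *)

Lemma size_rights A B (J : seq (A + B)) :
  size (rights J) = count (fun b => if b is inr _ then true else false) J.
Proof. by elim: J => [|[a|b] J IH] //=; rewrite -IH. Qed.

Section PolarBound.
Variables (F : fieldType) (N n u s t : nat) (T : finType).
Variables (S : T -> {set 'I_N}) (f : T -> 'I_n -> 'I_N -> F).
Variables (X : T -> 'I_n -> 'I_s + 'I_t -> F) (G : 'I_s + 'I_t -> 'I_N -> F).
Hypothesis fE : forall x m k, f x m k = \sum_b X x m b * G b k.
Hypothesis few_right : forall x, (#|[set m | [exists b, X x m (inr b) != 0%R]]| <= u)%N.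

Let word (J : {ffun 'I_n -> 'I_s + 'I_t}) := [seq J m | m <- enum 'I_n].

Lemma polar_key p (J J' : {ffun 'I_n -> 'I_s + 'I_t}) :
  key (word J) = key (word J') ->
  polar p (fun m => G (J m)) = polar p (fun m => G (J' m)).
Proof.
move=> /key_perm pJ.
have : perm_eq (mktuple J) (mktuple J') by [].
move=> /tuple_permP [q eq].
have Jq i : J i = J' (q i).
  rewrite -[LHS](tnth_mktuple J).
  have -> : mktuple J = [tuple tnth (mktuple J') (q i) | i < n] by apply: val_inj.
  by rewrite !tnth_mktuple.
rewrite -[RHS](polar_perm _ _ q); apply: eq_polar => m k.
by rewrite Jq.
Qed.

(** A right letter at a slot needs a nonzero right coordinate there, and at most [u] slots have
    one. *)
Lemma key_in x (J : {ffun 'I_n -> 'I_s + 'I_t}) :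
  \prod_m X x m (J m) != 0 -> key (word J) \in keys s t n u.
Proof.
move=> /prodf_neq0 nz; apply: mem_keys; first by rewrite size_map size_enum_ord.
apply: leq_trans (few_right x); rewrite size_rights count_map -size_filter.
rewrite cardE; apply: uniq_leq_size; [exact/filter_uniq/enum_uniq | move=> m].
rewrite mem_filter mem_enum inE /= => /andP[+ _].
case E: (J m) => [//|b] _; rewrite inE; apply/existsP; exists b.
by rewrite -E; apply: nz.
Qed.

Lemma card_le_polar :
  (forall x, polar (S x) (f x) != 0) ->
  (forall x y, x != y -> polar (S y) (f x) = 0) ->
  (#|T| <= size (keys s t n u))%N.
Proof.
move=> Hd Ho.
(* [A] holds the monomial coefficients of the product of forms, [B] what each monomial contributes
   to [polar]; by [polar_key] any word with key [k] will do. *)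
pose A x k := \sum_(J | key (word J) == k) \prod_m X x m (J m).
pose B k y := if [pick J | key (word J) == k] is Some J
  then polar (S y) (fun m => G (J m)) else 0.
have main x y : \sum_(k <- undup (keys s t n u)) A x k * B k y = polar (S y) (f x).
  have BE J : B (key (word J)) y = polar (S y) (fun m => G (J m)).
    rewrite /B; case: pickP => [J' /eqP /polar_key -> //|/(_ J)].
    by rewrite eqxx.
  transitivity (\sum_(k <- undup (keys s t n u)) \sum_(J | key (word J) == k)
      (\prod_m X x m (J m)) * B (key (word J)) y).
    apply: eq_bigr => k _; rewrite mulr_suml; apply: eq_bigr => J /eqP -> //.
  rewrite (exchange_big_dep xpredT) //=.
  rewrite (eq_polar _ (fE x)) polar_sum; apply: eq_bigr => J _; rewrite -BE.
  have [->|nz] := eqVneq (\prod_m X x m (J m)) 0.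
    by rewrite mul0r big1 // => *; rewrite mul0r.
  rewrite big_mkcond (bigD1_seq (key (word J))) ?undup_uniq ?mem_undup ?(key_in nz) //=.
  by rewrite eqxx [X in _ + X]big1 ?addr0 // => k /negbTE; rewrite eq_sym => ->.
apply: leq_trans (size_undup _); apply: (@card_le_diag_factor F _ _ _ A B).
  by move=> x; rewrite main.
by move=> x y ne; rewrite main Ho.
Qed.

End PolarBound.

(** * Functionals in general position *)

(** Where [y] has a nonzero entry [j], translating along the [j]-th unit vector gives [#|F|]
    disjoint copies of the hyperplane. *)
Lemma card_hyperplane (F : finFieldType) r (y : 'cV[F]_r) : y != 0 ->
  (#|F| * #|[set w : 'rV[F]_r | w *m y == 0%R]| <= #|{: 'rV[F]_r}|)%N.
Proof.
move=> /matrix0Pn [j [o yj]]; rewrite mulnC -cardsT -cardsX.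
pose g (wc : 'rV[F]_r * F) := wc.1 + wc.2 *: delta_mx 0 j.
rewrite -(card_in_imset (f := g)) ?max_card // => -[w c] [w' c'].
rewrite !inE /= !andbT => /eqP w0 /eqP w'0 e.
suff ec : c = c' by move: e; rewrite /g /= ec => /addIr ->.
move/(congr1 (fun z => (z *m y) 0 o)): e.
rewrite /g /= !mulmxDl w0 w'0 !add0r -!scalemxAl -rowE !mxE.
exact: mulIf.
Qed.

(** Union bound: each hyperplane fills at most a fraction 1/[#|F|] of the space. *)
Lemma avoid_hyperplanes (F : finFieldType) r (P : finType) (y : P -> 'cV[F]_r) :
  (forall p, y p != 0) -> (#|P| < #|F|)%N ->
  exists w : 'rV[F]_r, forall p, w *m y p != 0.
Proof.
move=> y0 lt; case: (pickP (fun w : 'rV[F]_r => [forall p, w *m y p != 0])).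
  by move=> w /forallP; exists w.
move=> no; move: lt; rewrite ltnNge => /negP []; set Q := #|{: 'rV[F]_r}|.
have Q0 : (0 < Q)%N by apply/card_gt0P; exists 0.
rewrite -(leq_pmul2r Q0) -[X in (_ <= X)%N]sum_nat_const.
apply: (@leq_trans (\sum_p #|F| * #|[set w : 'rV[F]_r | w *m y p == 0%R]|)%N); last first.
  by apply: leq_sum => p _; apply: card_hyperplane.
rewrite -big_distrr leq_mul2l; apply/orP; right.
have -> : Q = #|\bigcup_p [set w : 'rV[F]_r | w *m y p == 0%R]|.
  apply: eq_card => w; rewrite !inE; apply/esym/bigcupP.
  move/negbT: (no w); rewrite negb_forall => /existsP [p].
  by rewrite negbK => w0; exists p; rewrite ?inE.
rewrite -[X in (X <= _)%N]/(#|pred_of_set _|).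
elim/big_rec2: _ => [|p A B _ le]; first by rewrite cards0.
by rewrite (leq_trans (leq_card_setU _ _)) // leq_add2l.
Qed.

Lemma sub_col_mxl (F : fieldType) m1 m2 n (A : 'M[F]_(m1, n)) (B : 'M_(m2, n)) :
  (A <= col_mx A B)%MS.
Proof. by rewrite -addsmxE addsmxSl. Qed.

Lemma sub_col_mxr (F : fieldType) m1 m2 n (A : 'M[F]_(m1, n)) (B : 'M_(m2, n)) :
  (B <= col_mx A B)%MS.
Proof. by rewrite -addsmxE addsmxSr. Qed.

(** Rows of [W] are added one at a time. As [X p] has rank [t.+1], more than the rows so far, the
    bad next rows for [p] lie in a hyperplane, and fewer than [#|F|] hyperplanes can be avoided
    together. *)
Lemma generic_rows (F : finFieldType) r t (P : finType) (X : P -> 'M[F]_(t.+1, r))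
    (h : P -> 'rV[F]_t.+1) k :
  (forall p, row_free (X p)) -> (forall p, h p != 0) -> (#|P| < #|F|)%N ->
  (k <= t)%N ->
  exists W : 'M[F]_(k, r), forall p, row_free (col_mx (h p) (W *m (X p)^T)).
Proof.
move=> Xf h0 ltP; elim: k => [|k IH] ltk.
  exists 0 => p; rewrite -row_leq_rank -addsmxE (leq_trans _ (mxrankS (addsmxSl _ _))) //.
  by rewrite rank_rV h0.
have [W Wf] := IH (ltnW ltk).
have /fin_all_exists [y yP] p : exists y : 'cV[F]_r, y != 0 /\
    forall w : 'rV[F]_r, w *m y != 0 ->
      ~~ (w *m (X p)^T <= col_mx (h p) (W *m (X p)^T))%MS.
  set V := col_mx _ _.
  (* [w *m M = 0] exactly when [w *m (X p)^T] lies in the row space of [V]; a nonzero column of [M]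
     is the equation sought. *)
  pose M := (X p)^T *m cokermx V.
  have M0 : M != 0.
    apply/eqP => /eqP; rewrite -submxE => /mxrankS.
    rewrite mxrank_tr; move: (Xf p) (Wf p); rewrite /row_free -/V => /eqP -> /eqP ->.
    by rewrite leqNgt ltnS ltk.
  have /matrix0Pn [i [j Mij]] := M0.
  exists (col j M); split; first by apply/matrix0Pn; exists i, 0; rewrite mxE.
  move=> w; rewrite submxE -mulmxA -/M colE mulmxA; apply: contra => /eqP ->.
  by rewrite mul0mx.
have [w wP] := avoid_hyperplanes (fun p => (yP p).1) ltP.
exists (col_mx w W : 'M_(1 + k, r)) => p.
rewrite (mul_col_mx w W (X p)^T : (_ : 'M_(k.+1, _)) = _).
have nle := (yP p).2 _ (wP p).
set V := col_mx (h p) (W *m (X p)^T) in nle *; set a := w *m _ in nle *.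
rewrite -row_leq_rank; set V' := col_mx _ _.
have leW : (col_mx a (W *m (X p)^T) <= V')%MS by apply: sub_col_mxr.
have leV' : (V <= V')%MS.
  rewrite /V col_mx_sub sub_col_mxl /=; apply: submx_trans leW.
  exact: sub_col_mxr.
have : (V < V')%MS.
  rewrite ltmxE leV'; apply: contra nle; apply: submx_trans.
  by apply: submx_trans leW; apply: sub_col_mxl.
by move/rank_ltmx; have := Wf p; rewrite /row_free => /eqP ->.
Qed.

(** With [k = t] the matrix of [generic_rows] is square, hence invertible; [al p] is the transposed
    first column of its inverse. *)
Lemma generic_combinations (F : finFieldType) r t (P : finType)
    (X : P -> 'M[F]_(t.+1, r)) (h : P -> 'rV[F]_t.+1) :
  (forall p, row_free (X p)) -> (forall p, h p != 0) -> (0 < #|P| < #|F|)%N ->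
  exists2 W : 'M[F]_(t, r), row_free W &
    exists al : P -> 'rV[F]_t.+1, forall p,
      al p *m X p *m W^T = 0 /\ al p *m (h p)^T = 1.
Proof.
move=> Xf h0 /andP[/card_gt0P [p0 _] ltP].
have [W Wf] := generic_rows Xf h0 ltP (leqnn t); exists W.
  have /row_freeP [B] := Wf p0.
  rewrite mul_col_mx => /(congr1 dsubmx); rewrite col_mxKd => eB.
  apply/row_freeP; exists ((X p0)^T *m B *m (dsubmx 1%:M)^T).
  rewrite !mulmxA eB; apply/matrixP => i j; rewrite !mxE.
  rewrite (bigD1 (rshift 1 i)) //= big1 => [|k ne]; rewrite !mxE ?eqxx ?mul1r ?addr0.
    by rewrite eq_sym (inj_eq (@rshift_inj _ _)).
  by rewrite eq_sym (negbTE ne) mul0r.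
suff ex p : exists a, a *m X p *m W^T = 0 /\ a *m (h p)^T = 1.
  exact: fin_all_exists ex.
have /row_freeP [B ZB] := Wf p.
pose a := B *m (col_mx 1%:M 0 : 'M_(1 + t, 1)).
have : col_mx (h p) (W *m (X p)^T) *m a = col_mx 1%:M 0.
  by rewrite mulmxA ZB mul1mx.
rewrite mul_col_mx => /eq_col_mx [e1 e2]; exists a^T; split.
  by rewrite -mulmxA -[X p]trmxK -!trmx_mul e2 trmx0.
by rewrite -trmx_mul e1 trmx1.
Qed.

(** * Adapted bases, dual words and heights *)

Lemma rank_basis (F : fieldType) m n k (A : 'M[F]_(m, n)) :
  \rank A = k -> exists B : 'M[F]_(k, n), (B :=: A)%MS.
Proof. by move=> <-; exists (row_base A); apply: eq_row_base. Qed.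

Lemma adapted_basis (F : fieldType) r t (W : 'M[F]_(t, r)) : row_free W ->
  exists (B1 : 'M[F]_(r - t, r)) (B2 : 'M[F]_(t, r)),
    (forall x : 'rV_r, x *m W^T = 0 -> (x <= B1)%MS) /\
    (forall x : 'rV_r, (x <= col_mx B1 B2)%MS).
Proof.
move=> /eqP rW; have ler : (t <= r)%N by rewrite -rW rank_leq_col.
have rk : \rank (kermx W^T) = (r - t)%N by rewrite mxrank_ker mxrank_tr rW.
have [B1 e1] := rank_basis rk.
have [B2 e2] : exists B2 : 'M[F]_(t, r), (B2 :=: (kermx W^T)^C)%MS.
  by apply: rank_basis; rewrite mxrank_compl rk subKn.
exists B1, B2; split=> x; first by move=> x0; rewrite e1; apply/sub_kermxP.
rewrite -addsmxE (adds_eqmx e1 e2); apply: submx_full.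
exact: addsmx_compl_full.
Qed.

(** The word is e_i minus the sum of lambda_k e_k over [R]; as [c0] has a nonzero entry at [i], some
    lambda_k is nonzero. *)
Lemma dual_word (F : fieldType) N (C : {vspace 'rV[F]_N}) (i : 'I_N) (R : {set 'I_N}) c0 :
  recovering_set C i R -> i \notin R -> c0 \in C -> c0 0 i != 0 ->
  exists g : 'rV[F]_N,
    [/\ forall c, c \in C -> g *m c^T = 0, g 0 i = 1,
        forall k, g 0 k != 0 -> k = i \/ k \in R &
        exists2 k, k \in R & g 0 k != 0].
Proof.
move=> [lam lamE] iR c0C c0i.
pose g : 'rV[F]_N := \row_k ((k == i)%:R - (k \in R)%:R * lam k).
have gout k : k \notin R -> g 0 k = (k == i)%:R.
  by move=> /negbTE kR; rewrite mxE kR mul0r subr0.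
have gin k : k \in R -> g 0 k = - lam k.
  move=> kR; have /negbTE ki : k != i by apply: contraNneq iR => <-.
  by rewrite mxE kR ki mul1r sub0r.
exists g; split=> [c cC||k|].
- apply/matrixP => a b; rewrite !mxE !ord1.
  under eq_bigr do rewrite !mxE mulrBl -mulrA.
  rewrite sumrB (bigD1 i) //= eqxx mul1r [X in _ + X - _]big1 ?addr0; last first.
    by move=> k /negbTE ->; rewrite mul0r.
  rewrite (lamE _ cC) [X in X - _]big_mkcond -sumrB big1 // => k _.
  by case: (k \in R); rewrite ?mul1r ?mul0r subrr.
- by rewrite gout // eqxx.
- case: (boolP (k \in R)) => [_|kR]; first by right.
  have [->|/negbTE ki] := eqVneq k i; first by left.
  by rewrite gout // ki eqxx.
- case: (pickP [pred k | (k \in R) && (lam k != 0)]) => [k /andP[kR lk]|no].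
    by exists k => //; rewrite gin // oppr_eq0.
  case/negP: c0i; rewrite (lamE _ c0C) big1 // => k kR.
  by move: (no k); rewrite /= kR /= => /negbFE/eqP ->; rewrite mul0r.
Qed.

(** The height counts reachable vertices: [x] reaches all that [y] reaches, and also itself, which
    [y] does not. *)
Lemma acyclic_height (T : finType) (e : rel T) : acyclic_rel e ->
  exists h : T -> nat, forall x y, e x y -> (h y < h x)%N.
Proof.
move=> ac; exists (fun x => #|connect e x|) => x y exy; apply: proper_card.
apply/properP; split.
  apply/subsetP => z; rewrite -!topredE /=; apply: connect_trans.
  exact: connect1.
by exists x; rewrite -!topredE /= ?connect0 // ac.
Qed.

Lemma adapted_coordinates (F : fieldType) N r t (G : 'M[F]_(r, N)) (W : 'M[F]_(t, r)) :
  row_free W ->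
  exists Gf : 'I_(r - t) + 'I_t -> 'I_N -> F, forall z : 'rV_r,
    exists X : 'I_(r - t) + 'I_t -> F,
      (forall k, (z *m G) 0 k = \sum_b X b * Gf b k) /\
      (z *m W^T = 0 -> forall c, X (inr c) = 0).
Proof.
move=> /adapted_basis [B1 [B2 [sub0 full]]].
exists (fun b => match b with inl a => (B1 *m G) a | inr c => (B2 *m G) c end) => z.
suff [X1 [X2 [zE X20]]] : exists (X1 : 'rV_(r - t)) (X2 : 'rV_t),
    z = X1 *m B1 + X2 *m B2 /\ (z *m W^T = 0 -> X2 = 0).
  exists (fun b => match b with inl a => X1 0 a | inr c => X2 0 c end).
  split=> [k|/X20 -> c]; last by rewrite mxE.
  by rewrite zE mulmxDl -!mulmxA big_sumType !mxE.
(* A vector killed by [W] is expanded over [B1] alone; otherwise the implication is vacuous. *)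
have [z0|nz0] := eqVneq (z *m W^T) 0.
  have /submxP [X1 ->] := sub0 _ z0.
  by exists X1, 0; rewrite mul0mx addr0.
have /submxP [X zE] := full z.
exists (lsubmx X), (rsubmx X); rewrite -mul_row_col hsubmxK -zE; split=> // z0.
by rewrite z0 eqxx in nz0.
Qed.

Lemma fib2_owner N u (io : 'I_u -> 'I_N) (o : 'I_(u + u) -> 'I_u) :
  injective io -> (forall j, o (lshift u j) = j) -> (forall j, o (rshift u j) = j) ->
  fib2 (io @: setT) [ffun m => io (o m)].
Proof.
move=> ioI ol or; apply/forallP => k; apply/eqP.
case: imsetP => [[j _ ->]|no]; last first.
  apply/eqP; rewrite cards_eq0; apply/eqP/setP => m; rewrite !inE ffunE.
  by apply/negP => /eqP e; apply: no; exists (o m).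
have -> : [set m | [ffun m => io (o m)] m == io j] = [set lshift u j; rshift u j].
  apply/setP => m; rewrite !inE ffunE (inj_eq ioI).
  case: (split_ordP m) => j' ->; rewrite ?ol ?or.
    by rewrite (inj_eq (@lshift_inj _ _)) eq_lrshift orbF.
  by rewrite (inj_eq (@rshift_inj _ _)) eq_rlshift.
by rewrite cards2 eq_lrshift.
Qed.

(** * Ordered batch codes *)

Section Code.
Variables (F : finFieldType) (N n u t : nat) (C : {vspace 'rV[F]_N}).
Hypothesis Ccode : ordered_batch_code n u t.+2 C.

Lemma batch_code_length : (n <= N)%N.
Proof.
case: Ccode => _ [<- _].
by rewrite (leq_trans (dimvS (subvf C))) // dimvf /dim /= mul1n.
Qed.

Let em : 'I_n -> 'I_N := widen_ord batch_code_length.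

Let emI : injective em.
Proof. by move=> a b /(congr1 val) /= ab; apply: val_inj. Qed.

Lemma unit_codewords : exists cw : 'I_n -> 'rV[F]_N,
  forall j, cw j \in C /\ forall j', cw j 0 (em j') = (j == j')%:R.
Proof.
suff ex j : exists c, c \in C /\ forall j', c 0 (em j') = (j == j')%:R.
  exact: fin_all_exists ex.
have [c [[cC cE] _]] := Ccode.1 (delta_mx 0 j).
exists c; split=> // j'; rewrite (cE j') // mxE eqxx /= eq_sym //.
Qed.

(* io enumerates I, g j l is the dual word of the l-th recovering set of io j, and
   h is a height function of the digraph D_I. *)
Lemma request_words (I : {set 'I_n}) : #|I| = u ->
  exists d : ('I_u -> 'I_N) * ('I_u -> 'I_t.+2 -> 'rV[F]_N) * ('I_N -> nat),
  let: (io, g, h) := d in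
  [/\ injective io, em @: I = io @: setT,
      forall j l c, c \in C -> g j l *m c^T = 0,
      forall j l, g j l 0 (io j) = 1 &
  [/\ forall j l j' l' k, k \notin em @: I -> g j l 0 k != 0 -> g j' l' 0 k != 0 ->
        (j, l) = (j', l'),
      forall j l, exists2 k, g j l 0 k != 0 & forall l', g j l' 0 k != 0 -> l' = l &
      forall j l k, k \in em @: I -> g j l 0 k != 0 -> k = io j \/ (h k < h (io j))%N]].
Proof.
move=> cI.
have [R [Rrec Rdis Rac]] : exists R : 'I_N -> 'I_t.+2 -> {set 'I_N},
      [/\ forall i l, i \in em @: I -> recovering_set C i (R i l),
          forall i l i' l', i \in em @: I -> i' \in em @: I -> (i, l) != (i', l') ->
             [disjoint R i l & R i' l'] &
          acyclic_rel (DI_arc u (em @: I) R)].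
  by apply: Ccode.2.2 => [i /imsetP[j _ ->]|]; rewrite ?card_imset //=.
have [h hP] := acyclic_height Rac.
have [cw cwP] := unit_codewords.
pose io (j : 'I_u) := em (enum_val (cast_ord (esym cI) j)).
have ioI : injective io by move=> a b /emI/enum_val_inj/cast_ord_inj.
have ioin j : io j \in em @: I by apply/imset_f/enum_valP.
have eI : em @: I = io @: setT.
  apply/esym/eqP; rewrite eqEcard card_imset // cardsT card_ord card_imset // cI leqnn andbT.
  by apply/subsetP => _ /imsetP[j _ ->].
have arc i k l : i \in em @: I -> k \in em @: I -> k \in R i l -> (h k < h i)%N.
  by move=> iI kI kR; apply: hP; rewrite /DI_arc iI kI; apply/bigcupP; exists l.
(* A recovering set containing its own index would be a loop. *)
have ioR j l : io j \notin R (io j) l.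
  by apply/negP => /(arc _ _ _ (ioin j) (ioin j)); rewrite ltnn.
have /fin_all_exists [g gP] j : exists g : 'I_t.+2 -> 'rV[F]_N, forall l,
    [/\ forall c, c \in C -> g l *m c^T = 0, g l 0 (io j) = 1,
        forall k, g l 0 k != 0 -> k = io j \/ k \in R (io j) l &
        exists2 k, k \in R (io j) l & g l 0 k != 0].
  suff ex l : exists g : 'rV[F]_N,
    [/\ forall c, c \in C -> g *m c^T = 0, g 0 (io j) = 1,
        forall k, g 0 k != 0 -> k = io j \/ k \in R (io j) l &
        exists2 k, k \in R (io j) l & g 0 k != 0].
    exact: fin_all_exists ex.
  have [cC cE] := cwP (enum_val (cast_ord (esym cI) j)).
  by apply: (dual_word (Rrec _ l (ioin j)) (ioR j l) cC); rewrite cE eqxx oner_eq0.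
have Runi j l j' l' k : k \in R (io j) l -> k \in R (io j') l' -> (j, l) = (j', l').
  move=> k1 k2; apply/eqP; apply: contraTT k2 => ne.
  have : [disjoint R (io j) l & R (io j') l'].
    apply: Rdis => //; apply: contra ne; rewrite xpair_eqE.
    by move=> /andP[/eqP/ioI -> /eqP ->].
  by move=> /disjointFr /(_ k1) ->.
exists (io, g, h); split=> //.
- by move=> j l; case: (gP j l).
- by move=> j l; case: (gP j l).
split=> [j l j' l' k kI|j l|j l k kI].
- have nio j0 : k = io j0 -> False by move=> e; rewrite e ioin in kI.
  case: (gP j l) => _ _ s1 _ /s1 [/nio //|k1].
  by case: (gP j' l') => _ _ s2 _ /s2 [/nio //|k2]; apply: Runi k1 k2.
(* The witness is a point of the recovering set: disjointness keeps it out of the other words of the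
   same request. *)
- case: (gP j l) => _ _ _ [k kR gk]; exists k => // l' gk'.
  case: (gP j l') => _ _ /(_ k gk') [e|kR'] _.
    by move: kR; rewrite e (negbTE (ioR j l)).
  by case: (Runi _ _ _ _ _ kR kR').
- case: (gP j l) => _ _ /(_ k) s _ /s [|kR]; first by left.
  by right; apply: arc kI kR.
Qed.

(** The [n] unit codewords are independent, so their orthogonal space, which contains the dual code,
    has dimension [N - n]. *)
Lemma dual_basis : exists G : 'M[F]_(N - n, N), forall g : 'rV[F]_N,
  (forall c, c \in C -> g *m c^T = 0) -> (g <= G)%MS.
Proof.
have [cw cwP] := unit_codewords.
pose M := \matrix_(j < n) cw j.
have Mf : row_free M.
  apply/row_freeP; exists (\matrix_(k < N, j < n) (k == em j)%:R).
  apply/matrixP => j j'; rewrite !mxE (bigD1 (em j')) //= big1 => [|k /negbTE ne].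
    by rewrite !mxE eqxx mulr1 addr0 (cwP j).2.
  by rewrite !mxE ne mulr0.
have rk : \rank (kermx M^T) = (N - n)%N.
  by rewrite mxrank_ker mxrank_tr; move: Mf => /eqP ->.
have [G eG] := rank_basis rk; exists G => g gP; rewrite eG.
apply/sub_kermxP/trmx_inj; rewrite trmx_mul trmxK trmx0.
apply/row_matrixP => j; rewrite row_mul rowK row0.
by apply: trmx_inj; rewrite trmx_mul trmxK trmx0 gP // (cwP j).1.
Qed.

Hypothesis u0 : (0 < u)%N.
Hypothesis leun : (u <= n)%N.
Hypothesis ltq : (u * 'C(n, u) < #|F|)%N.

Let T := {I : {set 'I_n} | #|I| == u}.

Let cardT : #|{: T}| = 'C(n, u).
Proof. by rewrite card_sig -[n in RHS]card_ord -card_draws cardsE. Qed.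

Lemma binomial_le_keys : (t <= N - n)%N /\
  ('C(n, u) <= size (keys (N - n - t) t (u + u) u))%N.
Proof.
have [dd ddP] := fin_all_exists (fun x : T => request_words (eqP (valP x))).
pose io x := (dd x).1.1; pose g x := (dd x).1.2; pose h x := (dd x).2.
have [G GP] := dual_basis.
have wP x : [/\ injective (io x), em @: val x = io x @: setT,
      forall j l c, c \in C -> g x j l *m c^T = 0,
      forall j l, g x j l 0 (io x j) = 1 &
  [/\ forall j l j' l' k, k \notin em @: val x -> g x j l 0 k != 0 -> g x j' l' 0 k != 0 ->
        (j, l) = (j', l'),
      forall j l, exists2 k, g x j l 0 k != 0 & forall l', g x j l' 0 k != 0 -> l' = l &
      forall j l k, k \in em @: val x -> g x j l 0 k != 0 ->
        k = io x j \/ (h x k < h x (io x j))%N]].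
  by move: (ddP x); rewrite /io /g /h; case: (dd x) => [[]].
have /fin_all_exists [z zP] (p : T * 'I_u * 'I_t.+2) :
    exists z : 'rV_(N - n), g p.1.1 p.1.2 p.2 = z *m G.
  apply/submxP/GP => c cC; by case: (wP p.1.1) => _ _ /(_ p.1.2 p.2 c cC).
(* The last word is kept for b_j; the first [t.+1] are combined into a_j. *)
pose wd (l : 'I_t.+1) : 'I_t.+2 := widen_ord (leqnSn _) l.
have wdI : injective wd by move=> a b /(congr1 val) /= ab; apply: val_inj.
have wdmax l : wd l != ord_max by rewrite -val_eqE /= ltn_eqF.
pose X (p : T * 'I_u) := \matrix_(l < t.+1) z (p, wd l).
have XG p (al : 'rV_t.+1) k :
    (al *m X p *m G) 0 k = \sum_l al 0 l * g p.1 p.2 (wd l) 0 k.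
  rewrite -mulmxA mxE; apply: eq_bigr => l _; congr (_ * _).
  by rewrite (zP (p, wd l)) !mxE; apply: eq_bigr => i _; rewrite !mxE.
(* Each word has a position where the other words of its request vanish, which isolates its
   coefficient. *)
have Xfree p : row_free (X p).
  apply: inj_row_free => al al0; apply/matrixP => a l; rewrite ord1 mxE {a}.
  case: (wP p.1) => _ _ _ _ [_ /(_ p.2 (wd l)) [k gk kuni] _].
  have := XG p al k; rewrite al0 mul0mx mxE (bigD1 l) //= big1 ?addr0.
    by move/esym/eqP; rewrite mulf_eq0 (negbTE gk) orbF => /eqP.
  move=> l' ne; have [->|/kuni /wdI e] := eqVneq (g p.1 p.2 (wd l') 0 k) 0.
    by rewrite mulr0.
  by rewrite e eqxx in ne.
have T0 : (0 < #|{: T}|)%N by rewrite cardT bin_gt0.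
(* Words have entry 1 at their request, so pairing with the all-ones row gives the entry of a_j
   there. *)
have h0 (p : T * 'I_u) : const_mx 1 != 0 :> 'rV[F]_t.+1.
  by apply/matrix0Pn; exists 0, 0; rewrite mxE oner_eq0.
have cardP : (0 < #|{: T * 'I_u}| < #|F|)%N.
  by rewrite card_prod cardT card_ord muln_gt0 -cardT T0 u0 cardT mulnC.
have [W Wf [al alP]] := generic_combinations Xfree h0 cardP.
split; first by rewrite -(eqP Wf) rank_leq_col.
(* slots lshift u j carry a_j, slots rshift u j carry b_j *)
pose coord x (m : 'I_(u + u)) : 'rV_(N - n) := match split m with
  | inl j => al (x, j) *m X (x, j) | inr j => z (x, j, ord_max) end.
pose f x m k : F := (coord x m *m G) 0 k.
pose o (m : 'I_(u + u)) := match split m with inl j => j | inr j => j end.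
have ol j : o (lshift u j) = j by rewrite /o -[lshift u j]/(unsplit (inl j)) unsplitK.
have or j : o (rshift u j) = j by rewrite /o -[rshift u j]/(unsplit (inr j)) unsplitK.
have fl x j k : f x (lshift u j) k = \sum_l al (x, j) 0 l * g x j (wd l) 0 k.
  by rewrite /f /coord -[lshift u j]/(unsplit (inl j)) unsplitK XG.
have fr x j k : f x (rshift u j) k = g x j ord_max 0 k.
  by rewrite /f /coord -[rshift u j]/(unsplit (inr j)) unsplitK -(zP (x, j, ord_max)).
(* A support point of a form lies in the support of one of its words, whose index tells a_j slots
   from b_j slots. *)
have fword x m k : f x m k != 0 -> exists2 l, g x (o m) l 0 k != 0 &
    (l == ord_max) = (u <= m)%N.
  case: (split_ordP m) => j ->; rewrite ?ol ?or ?fl ?fr => fk; last first.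
    by exists ord_max => //; rewrite eqxx /= leq_addr.
  have [l gl|no] := pickP (fun l => g x j (wd l) 0 k != 0).
    by exists (wd l) => //; rewrite (negbTE (wdmax l)) leqNgt /= ltn_ord.
  case/eqP: fk; apply: big1 => l _.
  by move/negbFE/eqP: (no l) => ->; rewrite mulr0.
have fown x m : f x m (io x (o m)) = 1.
  case: (wP x) => _ _ _ g1 _.
  case: (split_ordP m) => j ->; rewrite ?ol ?or ?fl ?fr ?g1 //.
  have [_ /(congr1 (fun A : 'M_1 => A 0 0))] := alP (x, j).
  rewrite !mxE eqxx mulr1n => <-; apply: eq_bigr => l _.
  by rewrite g1 !mxE.
have [Gf GfP] := adapted_coordinates G Wf.
have /fin_all_exists [co coP] (p : T * 'I_(u + u)) := GfP (coord p.1 p.2).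
rewrite -cardT.
apply: (@card_le_polar _ _ _ _ _ _ (T : finType) (fun x => em @: val x) f
          (fun x m => co (x, m)) Gf) => [x m k|x|x|x y ne].
- by rewrite /f (coP (x, m)).1.
(* The a_j are killed by [W], so only the [u] slots of the b_j can have right coordinates. *)
- rewrite -[X in (_ <= X)%N]card_ord -cardsT.
  apply: leq_trans (leq_imset_card (@rshift u u) _); apply: subset_leq_card.
  apply/subsetP => m; rewrite inE => /existsP [b].
  case: (split_ordP m) => j ->; last by rewrite imset_f.
  rewrite (coP (x, lshift u j)).2 ?eqxx //.
  rewrite /coord /= -[lshift u j]/(unsplit (inl j)) unsplitK.
  exact: (alP (x, j)).1.
- case: (wP x) => ioI eS _ _ [_ _ low].
  apply: (polar_neq0 (own := [ffun m => io x (o m)]) (h := h x)).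
  + by rewrite eS; apply: fib2_owner.
  + by move=> m; rewrite ffunE fown oner_eq0.
  + by move=> m k kS /fword [l gl _]; rewrite ffunE; apply: low gl.
have [k kS kNS] : exists2 k, k \in em @: val y & k \notin em @: val x.
  apply/subsetPn; apply: contra ne => sub; rewrite eq_sym.
  have : em @: val y == em @: val x.
    by rewrite eqEcard sub !card_imset // (eqP (valP x)) (eqP (valP y)) leqnn.
  by move/eqP/(imset_inj emI)/val_inj ->.
(* Outside the request set [k] determines [j] and [l], and [l] separates a_j from b_j: the slot is
   unique. *)
apply: (polar_eq0 kS) => m m' /fword [l gl lm] /fword [l' gl' lm'].
case: (wP x) => _ _ _ _ [/(_ _ _ _ _ _ kNS gl gl') [eo el] _ _].
move: lm lm' eo; rewrite el => ->.
case: (split_ordP m) => j ->; case: (split_ordP m') => j' ->; rewrite ?ol ?or /=.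
- by move=> _ ->.
- by rewrite leq_addr leqNgt ltn_ord.
- by rewrite leq_addr leqNgt ltn_ord.
- by move=> _ ->.
Qed.

End Code.

(* binomials are ssrnat's 'C(a, b), which is 0 when a < b; the subtractions are
   truncated, which only produces arguments a = 0 < b, where 'C(a,b) = 0 as required *)
Theorem theorem1 (F : finFieldType) (N n u v : nat) (C : {vspace 'rV[F]_N}) :
  (0 < u)%N -> (0 < v)%N ->
  ordered_batch_code n u v C ->
  (maxn (4 * u * 'C(n, u)) 7 <= #|F|)%N ->
  (2 <= v)%N -> (u * v <= n)%N ->
  let r := (N - n)%N in
  ('C(r + 2 * u + 1 - v, 2 * u)
     + \sum_(1 <= i < u.+1) 'C(r + 2 * u + 1 - (v + i), 2 * u - i) * 'C(v + i - 3, i)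
   >= 'C(n, u))%N.
Proof.
move=> u0 _ Ccode q v2; case: v v2 Ccode => [|[|t]] // _ Ccode uvn; cbv zeta.
move: q; rewrite geq_max => /andP[q4 _].
have leun : (u <= n)%N by apply: leq_trans uvn; rewrite leq_pmulr.
have c0 : (0 < 'C(n, u))%N by rewrite bin_gt0.
have ltq : (u * 'C(n, u) < #|F|)%N by nia.
have [ler le] := binomial_le_keys Ccode u0 leun ltq.
(* The term [i = 0] is the leading binomial, its cofactor being 1. *)
apply: leq_trans le _; rewrite size_keys big_ltn // leq_add //.
  rewrite -[X in (_ <= X)%N]muln1 leq_mul ?bin0 // subn0.
  (* [ler] makes the truncated [N - n - t] exact. *)
  have -> : (N - n - t + (u + u) - 1 = N - n + 2 * u + 1 - t.+2)%N by lia.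
  by rewrite mul2n addnn.
rewrite big_nat [X in (_ <= X)%N]big_nat leq_sum // => i /andP[i1 iu].
rewrite leq_mul //.
have -> : (N - n - t + (u + u - i) - 1 = N - n + 2 * u + 1 - (t.+2 + i))%N by lia.
by rewrite mul2n addnn.
Qed.
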